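(* Let $X$ be a set. Every homomorphic image of the algebra $\mathrm{DerPerm}_{\succ}\langle X\rangle$ is special; that is, for every ideal $\alpha$ of the algebra $(\mathrm{DerPerm}_{\succ}\langle X\rangle,\succ)$ there exist a perm algebra $A$ with a derivation $d$ and an injective algebra homomorphism from $\mathrm{DerPerm}_{\succ}\langle X\rangle/\alpha$ into $(A,\succ)$, where $a\succ b=d(a)b$ on $A$.
   Context: All algebras are over a fixed field $\mathbb K$. A perm algebra is an associative (not necessarily unital) algebra satisfying $abc=bac$. $\mathrm{DerPerm}\langle X\rangle$ is the free perm algebra with a derivation $d$ generated by the set $X$. $\mathrm{DerPerm}_{\succ}\langle X\rangle$ is the subalgebra generated by $X$ of the space $\mathrm{DerPerm}\langle X\rangle$ equipped with the single bilinear operation $a\succ b=d(a)b$. An algebra with one bilinear operation $\succ$ is called special if it embeds into $(A,\succ)$, $a\succ b=d(a)b$, for some perm algebra $A$ with derivation $d$. *)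

(* Defs.v *)
From HB Require Import structures.
From mathcomp Require Import all_boot all_algebra.
From mathcomp Require Import boolp classical_sets.

Set Implicit Arguments.
Unset Strict Implicit.
Unset Printing Implicit Defensive.

Import GRing.Theory.

Local Open Scope ring_scope.
Local Open Scope classical_set_scope.
Local Open Scope quotient_scope.

(* MathComp's algebras are unital and associative; the ones below are neither,
   so the product is called bop and the hierarchy starts again from lmodType. *)

HB.mixin Record hasBilinearProduct (K : fieldType) A of GRing.Lmodule K A := {
  bop : A -> A -> A;
  bop_linearl : forall b, linear (bop^~ b);
  bop_linearr : forall a, linear (bop a)
}.

#[short(type="bilinAlgType")]
HB.structure Definition BilinAlg (K : fieldType) :=
  {A of hasBilinearProduct K A & GRing.Lmodule K A}.

HB.mixin Record isPerm (K : fieldType) A of BilinAlg K A := {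
  bopA : associative (bop : A -> A -> A);
  bop_perm : forall a b c : A, bop (bop a b) c = bop (bop b a) c
}.

#[short(type="permAlgType")]
HB.structure Definition PermAlg (K : fieldType) :=
  {A of isPerm K A & BilinAlg K A}.

HB.mixin Record hasDerivation (K : fieldType) A of PermAlg K A := {
  der : A -> A;
  der_linear : linear der;
  derM : forall a b : A, der (bop a b) = bop (der a) b + bop a (der b)
}.

#[short(type="derPermAlgType")]
HB.structure Definition DerPermAlg (K : fieldType) :=
  {A of hasDerivation K A & PermAlg K A}.

Definition is_alg_hom (K : fieldType) (A B : bilinAlgType K) (f : A -> B) :=
  linear f /\ {morph f : a b / bop a b}.

Definition is_der_hom (K : fieldType) (A B : derPermAlgType K) (f : A -> B) :=
  is_alg_hom f /\ {morph f : a / der a}.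

Definition is_free_der_perm (K : fieldType) (X : Type) (F : derPermAlgType K)
    (i : X -> F) : Prop :=
  forall (A : derPermAlgType K) (g : X -> A),
    exists2 f : F -> A,
      is_der_hom f /\ (forall x, f (i x) = g x) &
      forall f' : F -> A,
        is_der_hom f' -> (forall x, f' (i x) = g x) -> f' =1 f.

(* The space A with the single product a > b = d(a)b. *)
Definition succ_alg (K : fieldType) (A : derPermAlgType K) : Type := A.

Section SuccAlg.
Variables (K : fieldType) (A : derPermAlgType K).

HB.instance Definition _ := GRing.Lmodule.on (succ_alg A).

Let sop (a b : succ_alg A) : succ_alg A := bop (der (a : A)) (b : A).

Let sop_linearl b : linear (sop^~ b).
Proof. by move=> k x y; rewrite /sop der_linear bop_linearl. Qed.

Let sop_linearr a : linear (sop a).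
Proof. by move=> k x y; rewrite /sop bop_linearr. Qed.

HB.instance Definition _ :=
  hasBilinearProduct.Build K (succ_alg A) sop_linearl sop_linearr.

Lemma succE (a b : A) : bop (a : succ_alg A) b = bop (der a) b.
Proof. by []. Qed.

End SuccAlg.

Definition is_special (K : fieldType) (B : bilinAlgType K) : Prop :=
  exists (A : derPermAlgType K) (f : B -> succ_alg A),
    is_alg_hom f /\ injective f.

Definition is_subspace (K : fieldType) (A : lmodType K) (S : set A) : Prop :=
  S 0 /\ forall (k : K) a b, S a -> S b -> S (k *: a + b).

Definition is_subalg (K : fieldType) (A : bilinAlgType K) (S : set A) : Prop :=
  is_subspace S /\ forall a b, S a -> S b -> S (bop a b).

Definition is_ideal (K : fieldType) (A : bilinAlgType K) (I : set A) : Prop :=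
  is_subspace I /\ forall a b, I a -> I (bop a b) /\ I (bop b a).

Section GeneratedSubalgebra.
Variables (K : fieldType) (A : bilinAlgType K) (G : set A).

Definition gen_pred : {pred A} := fun a => a \in smallest (@is_subalg K A) G.

Lemma gen_predP a : reflect (smallest (@is_subalg K A) G a) (a \in gen_pred).
Proof. exact: asboolP. Qed.

Let gen_submod_closed : submod_closed gen_pred.
Proof.
split=> [|k a b /gen_predP ha /gen_predP hb]; apply/gen_predP => S [hS GS].
  by have [[]] := hS.
by have [[_ +] _] := hS; apply; [apply: ha|apply: hb].
Qed.

HB.instance Definition _ :=
  GRing.isSubmodClosed.Build K A gen_pred gen_submod_closed.

Record gen_subalg : Type :=
  GenSubalg { gen_val : A; gen_valP : gen_val \in gen_pred }.

HB.instance Definition _ := [isSub for gen_val].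
HB.instance Definition _ := [Choice of gen_subalg by <:].
HB.instance Definition _ := [SubChoice_isSubLmodule of gen_subalg by <:].

Lemma gen_val_linear : linear gen_val.
Proof. exact: (linearP (val : gen_subalg -> A)). Qed.

Lemma gen_val_inj : injective gen_val.
Proof. exact: val_inj. Qed.

Let gen_pred_bop a b :
  a \in gen_pred -> b \in gen_pred -> bop a b \in gen_pred.
Proof.
move=> /gen_predP ha /gen_predP hb; apply/gen_predP => S [hS GS].
by have [_] := hS; apply; [apply: ha|apply: hb].
Qed.

Let gen_bop (a b : gen_subalg) : gen_subalg :=
  GenSubalg (gen_pred_bop (gen_valP a) (gen_valP b)).

Let gen_bop_linearl b : linear (gen_bop^~ b).
Proof.
by move=> k x y; apply: gen_val_inj; rewrite [RHS]gen_val_linear/= bop_linearl.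
Qed.

Let gen_bop_linearr a : linear (gen_bop a).
Proof.
by move=> k x y; apply: gen_val_inj; rewrite [RHS]gen_val_linear/= bop_linearr.
Qed.

HB.instance Definition _ :=
  hasBilinearProduct.Build K gen_subalg gen_bop_linearl gen_bop_linearr.

Lemma gen_valM (a b : gen_subalg) : gen_val (bop a b) = bop (gen_val a) (gen_val b).
Proof. by []. Qed.

End GeneratedSubalgebra.

Definition DerPerm_succ (K : fieldType) (X : Type) (F : derPermAlgType K)
    (i : X -> F) : bilinAlgType K :=
  gen_subalg (range i : set (succ_alg F)).

Section QuotientAlgebra.
Variables (K : fieldType) (A : bilinAlgType K) (I : set A) (hI : is_ideal I).

Let I0 : I 0. Proof. by case: hI => [[]]. Qed.

Let IP k a b : I a -> I b -> I (k *: a + b).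
Proof. by case: hI => [[_ h] _]; apply: h. Qed.

Let ID a b : I a -> I b -> I (a + b).
Proof. by rewrite -{2}(scale1r a); apply: IP. Qed.

Let IZ k a : I a -> I (k *: a).
Proof. by move=> ha; rewrite -(addr0 (k *: a)); apply: IP. Qed.

Definition ideal_rel (a b : A) : bool := `[< I (a - b) >].

Let ideal_rel_refl : reflexive ideal_rel.
Proof. by move=> a; apply/asboolP; rewrite subrr. Qed.

Let ideal_rel_sym : symmetric ideal_rel.
Proof.
by move=> a b; apply/asboolP/asboolP => h; rewrite -opprB -scaleN1r; apply: IZ.
Qed.

Let ideal_rel_trans : transitive ideal_rel.
Proof.
move=> b a c /asboolP h1 /asboolP h2; apply/asboolP.
by rewrite -(subrKA b); apply: ID.
Qed.

Canonical ideal_equiv :=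
  EquivRel ideal_rel ideal_rel_refl ideal_rel_sym ideal_rel_trans.

Definition quot_alg : Type := {eq_quot ideal_equiv}.

HB.instance Definition _ := Choice.on quot_alg.
HB.instance Definition _ := EqQuotient.on quot_alg.

Let pi (a : A) : quot_alg := \pi a.

Lemma quot_eqP a b : reflect (I (a - b)) (\pi_quot_alg a == \pi_quot_alg b).
Proof. by rewrite eqmodE; exact: asboolP. Qed.

Let pi_eq a b : I (a - b) -> pi a = pi b.
Proof. by move=> h; apply/eqP/quot_eqP. Qed.

Let repr_pi a : I (repr (pi a) - a).
Proof. by apply/quot_eqP; rewrite reprK. Qed.

Let qadd (x y : quot_alg) := pi (repr x + repr y).
Let qscale (k : K) (x : quot_alg) := pi (k *: repr x).
Let qbop (x y : quot_alg) := pi (bop (repr x) (repr y)).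

Let qaddE a b : qadd (pi a) (pi b) = pi (a + b).
Proof. by apply: pi_eq; rewrite opprD addrACA; apply: ID. Qed.

Let qscaleE k a : qscale k (pi a) = pi (k *: a).
Proof. by apply: pi_eq; rewrite -scalerBr; apply: IZ. Qed.

Let bopBl (a b c : A) : bop (a - b) c = bop a c - bop b c.
Proof.
by rewrite addrC -scaleN1r bop_linearl scaleN1r addrC.
Qed.

Let bopBr (a b c : A) : bop c (a - b) = bop c a - bop c b.
Proof.
by rewrite addrC -scaleN1r bop_linearr scaleN1r addrC.
Qed.

Let qbopE a b : qbop (pi a) (pi b) = pi (bop a b).
Proof.
apply: pi_eq; have [_ hM] := hI.
rewrite -(subrKA (bop a (repr (pi b)))) -bopBl -bopBr.
by apply: ID; [have [] := hM _ (repr (pi b)) (repr_pi a)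
             |have [] := hM _ a (repr_pi b)].
Qed.

Let piW (P : quot_alg -> Prop) : (forall a, P (pi a)) -> forall x, P x.
Proof. by move=> h x; rewrite -[x]reprK; apply: h. Qed.

Let qaddA : associative qadd.
Proof.
by elim/piW=> a; elim/piW=> b; elim/piW=> c; rewrite !qaddE addrA.
Qed.

Let qaddC : commutative qadd.
Proof. by elim/piW=> a; elim/piW=> b; rewrite !qaddE addrC. Qed.

Let qadd0 : left_id (pi 0) qadd.
Proof. by elim/piW=> a; rewrite qaddE add0r. Qed.

Let qaddN : left_inverse (pi 0) (qscale (-1)) qadd.
Proof. by elim/piW=> a; rewrite qscaleE qaddE scaleN1r addNr. Qed.

HB.instance Definition _ :=
  GRing.isZmodule.Build quot_alg qaddA qaddC qadd0 qaddN.

Let qscaleA a b v : qscale a (qscale b v) = qscale (a * b) v.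
Proof. by elim/piW: v => v; rewrite !qscaleE scalerA. Qed.

Let qscale1 : left_id 1 qscale.
Proof. by elim/piW=> v; rewrite qscaleE scale1r. Qed.

Let qscaleDr : right_distributive qscale +%R.
Proof.
move=> k; elim/piW=> a; elim/piW=> b.
by rewrite /GRing.add/= !(qscaleE, qaddE) scalerDr.
Qed.

Let qscaleDl v : {morph qscale^~ v : a b / a + b}.
Proof.
move=> a b; elim/piW: v => v.
by rewrite [RHS]/GRing.add/= !qscaleE qaddE scalerDl.
Qed.

HB.instance Definition _ := GRing.Zmodule_isLmodule.Build K quot_alg
  qscaleA qscale1 qscaleDr qscaleDl.

Let pi_linear : linear pi.
Proof.
by move=> k a b; rewrite /GRing.scale/= /GRing.add/= qscaleE qaddE.
Qed.

Let qbop_linearl b : linear (qbop^~ b).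
Proof.
elim/piW: b => b k; elim/piW=> x; elim/piW=> y.
by rewrite -pi_linear !qbopE bop_linearl pi_linear.
Qed.

Let qbop_linearr a : linear (qbop a).
Proof.
elim/piW: a => a k; elim/piW=> x; elim/piW=> y.
by rewrite -pi_linear !qbopE bop_linearr pi_linear.
Qed.

HB.instance Definition _ :=
  hasBilinearProduct.Build K quot_alg qbop_linearl qbop_linearr.

Lemma quot_pi_hom : is_alg_hom (\pi_quot_alg : A -> quot_alg).
Proof. by split=> [|a b]; [exact: pi_linear|exact/esym/qbopE]. Qed.

End QuotientAlgebra.

(* Existence of the free perm algebra with a derivation: terms modulo the
   identities valid in every such algebra. *)
Section FreeExists.
Variables (K : fieldType) (X : Type).

Inductive term : Type :=
  | Var of X
  | Zero
  | Add of term & term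
  | Scale of K & term
  | Mul of term & term
  | Der of term.

HB.instance Definition _ := gen_eqMixin term.
HB.instance Definition _ := gen_choiceMixin term.

Fixpoint eval (A : derPermAlgType K) (g : X -> A) (t : term) : A :=
  match t with
  | Var x => g x
  | Zero => 0
  | Add s u => eval g s + eval g u
  | Scale k s => k *: eval g s
  | Mul s u => bop (eval g s) (eval g u)
  | Der s => der (eval g s)
  end.

Let trel (s t : term) : bool :=
  `[< forall (A : derPermAlgType K) (g : X -> A), eval g s = eval g t >].

Let trel_refl : reflexive trel.
Proof. by move=> t; apply/asboolP. Qed.

Let trel_sym : symmetric trel.
Proof. by move=> s t; apply/asboolP/asboolP => h A g; rewrite h. Qed.

Let trel_trans : transitive trel.
Proof.
by move=> t s u /asboolP h1 /asboolP h2; apply/asboolP => A g; rewrite h1.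
Qed.

Canonical term_equiv := EquivRel trel trel_refl trel_sym trel_trans.

Definition free_der_perm : Type := {eq_quot term_equiv}.

HB.instance Definition _ := Choice.on free_der_perm.
HB.instance Definition _ := EqQuotient.on free_der_perm.

Let pi (t : term) : free_der_perm := \pi t.

Let ev (A : derPermAlgType K) (g : X -> A) (x : free_der_perm) : A :=
  eval g (repr x).

Let ev_pi A g t : @ev A g (pi t) = eval g t.
Proof.
have /eqmodP/asboolP h : repr (pi t) = t %[mod free_der_perm] by rewrite reprK.
exact: h.
Qed.

Let ev_inj x y : (forall A g, @ev A g x = ev g y) -> x = y.
Proof.
by move=> h; rewrite -[x]reprK -[y]reprK; apply/eqmodP/asboolP => A g; apply: h.
Qed.

Let tadd (x y : free_der_perm) := pi (Add (repr x) (repr y)).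
Let tscale k (x : free_der_perm) := pi (Scale k (repr x)).
Let tmul (x y : free_der_perm) := pi (Mul (repr x) (repr y)).
Let tder (x : free_der_perm) := pi (Der (repr x)).

Let evD A g x y : @ev A g (tadd x y) = ev g x + ev g y.
Proof. exact: ev_pi. Qed.
Let evZ A g k x : @ev A g (tscale k x) = k *: ev g x.
Proof. exact: ev_pi. Qed.
Let evM A g x y : @ev A g (tmul x y) = bop (ev g x) (ev g y).
Proof. exact: ev_pi. Qed.
Let ev_der A g x : @ev A g (tder x) = der (ev g x).
Proof. exact: ev_pi. Qed.
Let ev0 A g : @ev A g (pi Zero) = 0.
Proof. exact: ev_pi. Qed.

Let evE := (evD, evZ, evM, ev_der, ev0).

Let taddA : associative tadd.
Proof. by move=> x y z; apply: ev_inj => A g; rewrite !evE addrA. Qed.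
Let taddC : commutative tadd.
Proof. by move=> x y; apply: ev_inj => A g; rewrite !evE addrC. Qed.
Let tadd0 : left_id (pi Zero) tadd.
Proof. by move=> x; apply: ev_inj => A g; rewrite !evE add0r. Qed.
Let taddN : left_inverse (pi Zero) (tscale (-1)) tadd.
Proof. by move=> x; apply: ev_inj => A g; rewrite !evE scaleN1r addNr. Qed.

HB.instance Definition _ :=
  GRing.isZmodule.Build free_der_perm taddA taddC tadd0 taddN.

Let tscaleA a b v : tscale a (tscale b v) = tscale (a * b) v.
Proof. by apply: ev_inj => A g; rewrite !evE scalerA. Qed.
Let tscale1 : left_id 1 tscale.
Proof. by move=> x; apply: ev_inj => A g; rewrite !evE scale1r. Qed.
Let tscaleDr : right_distributive tscale +%R.
Proof. by move=> k x y; apply: ev_inj => A g; rewrite !evE scalerDr. Qed.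
Let tscaleDl v : {morph tscale^~ v : a b / a + b}.
Proof. by move=> a b; apply: ev_inj => A g; rewrite !evE scalerDl. Qed.

HB.instance Definition _ := GRing.Zmodule_isLmodule.Build K free_der_perm
  tscaleA tscale1 tscaleDr tscaleDl.

Let ev_linear A g : linear (@ev A g).
Proof. by move=> k x y; rewrite evD evZ. Qed.

Let tmul_linearl b : linear (tmul^~ b).
Proof.
by move=> k x y; apply: ev_inj => A g; rewrite ev_linear !evM ev_linear bop_linearl.
Qed.
Let tmul_linearr a : linear (tmul a).
Proof.
by move=> k x y; apply: ev_inj => A g; rewrite ev_linear !evM ev_linear bop_linearr.
Qed.

HB.instance Definition _ :=
  hasBilinearProduct.Build K free_der_perm tmul_linearl tmul_linearr.

Let tmulA : associative tmul.
Proof. by move=> x y z; apply: ev_inj => A g; rewrite !evM bopA. Qed.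
Let tmul_perm a b c : tmul (tmul a b) c = tmul (tmul b a) c.
Proof. by apply: ev_inj => A g; rewrite !evM bop_perm. Qed.

HB.instance Definition _ := isPerm.Build K free_der_perm tmulA tmul_perm.

Let tder_linear : linear tder.
Proof.
move=> k x y; apply: ev_inj => A g.
by rewrite ev_linear !ev_der ev_linear der_linear.
Qed.
Let tderM a b : tder (tmul a b) = tmul (tder a) b + tmul a (tder b).
Proof. by apply: ev_inj => A g; rewrite !evE derM. Qed.

HB.instance Definition _ := hasDerivation.Build K free_der_perm tder_linear tderM.

Definition free_gen (x : X) : free_der_perm :=
  \pi_free_der_perm (Var x).

Lemma free_gen_is_free : is_free_der_perm free_gen.
Proof.
move=> A g; exists (ev g).
  split=> [|x]; last exact: ev_pi.
  by split; [split; [exact: ev_linear|exact: evM]|exact: ev_der].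
move=> f [[fL fM] fD] fg.
have f0 : f 0 = 0 by have := fL (-1) 0 0; rewrite scaler0 addr0 scaleN1r addNr.
have fZ k x : f (k *: x) = k *: f x by rewrite -[k *: x]addr0 fL f0 addr0.
have fA x y : f (x + y) = f x + f y by rewrite -{1}(scale1r x) fL scale1r.
have piD s t : pi (Add s t) = pi s + pi t.
  by apply: ev_inj => B h; rewrite evD !ev_pi.
have piZ k t : pi (Scale k t) = k *: pi t.
  by apply: ev_inj => B h; rewrite evZ !ev_pi.
have piM s t : pi (Mul s t) = bop (pi s) (pi t).
  by apply: ev_inj => B h; rewrite evM !ev_pi.
have pi_der t : pi (Der t) = der (pi t).
  by apply: ev_inj => B h; rewrite ev_der !ev_pi.
move=> x; rewrite -{1}[x]reprK /ev.
elim: (repr x) => //= [s IHs t IHt|k t IHt|s IHs t IHt|t IHt].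
- by rewrite [\pi _]piD fA IHs IHt.
- by rewrite [\pi _]piZ fZ IHt.
- by rewrite [\pi _]piM fM IHs IHt.
- by rewrite [\pi _]pi_der fD IHt.
Qed.

End FreeExists.

(* Main.v *)
Require Import Defs.
From HB Require Import structures.
From mathcomp Require Import all_boot all_algebra.
From mathcomp Require Import boolp classical_sets functions.
From mathcomp Require Import zify.

Set Implicit Arguments.
Unset Strict Implicit.
Unset Printing Implicit Defensive.

Import GRing.Theory.

Local Open Scope ring_scope.
Local Open Scope classical_set_scope.

(** The statement holds because every homomorphic image of a special algebra
    is special ([special_image]); [DerPerm_succ i] is special by construction.

    Let B embed in (F, >), where a > b = d(a)b, let A be the image of B in F,
    let pi : B -> V be onto, and let alpha, a subset of A, be the image of its
    kernel.  In F a product depends on its left factors only through the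
    operators L_f = bop f, which commute.  The words in the operators
    L_{d^k a}, a in A, are graded by weight: L_{d^k a} has weight k - 1.  A word
    of weight 0 maps A into A and alpha into alpha, and if one of its letters
    comes from alpha it maps A into alpha; the last fact is the heart of the
    matter, since it is what prevents the differential ideal generated by alpha
    from meeting A outside alpha.  A word need not be a composite of operators
    L_{d(a)}, so this is not visible letter by letter.  It is obtained by enlarging the
    words to spaces R_w of operators of weight w, with subspaces J_w for the
    words with a letter from alpha ([hom_op], the boolean telling J from R).
    For w < 0 these are spanned by products of -w letters; for w >= 0 an
    operator lies in R_w when its products with the elements of A and alpha lie
    in R_(w-1) and J_(w-1), where in weight -1 one reads A and alpha.
    They are then stable under multiplication by letters almost by definition,
    and under p |-> [d, p] by an induction that uses only the Leibniz rule and
    d(a)b in A ([hom_op_der]).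

    The algebra containing V is built from the V-valued functionals on the
    spaces R_w that vanish on the J_w ([dual]).  Multiplication by a letter acts
    on them by precomposition, and d acts by T |-> - T o [d, _], as in
    integration by parts; the commutator of d with multiplication by d^k a is
    multiplication by d^(k+1) a.  The element b of B is sent to the pair of the
    operator of multiplication by b and the functional
    p |-> pi (p b) (p in R_0), which is zero in the other weights.  Such pairs
    (f, w) multiply by (f, w)(g, u) = (f g, f u), which is a perm product as
    soon as the operators f commute, and ([D, f], D w) is a derivation; the
    operators range over the bicommutant of the multiplications by letters,
    which is commutative and stable under [D, _] because the set of these
    multiplications is ([bicommutant_alg]).  The map kills the kernel of pi
    because the functionals vanish on J and R_0 maps alpha into itself;
    evaluation of the functional of b at the identity operator recovers pi b,
    so V embeds. *)

(** * Subspaces as modules *)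

Section Subspace.
Variables (K : fieldType) (V : lmodType K) (S : set V) (hS : is_subspace S).

(** The proof that S is a subspace is an argument so that the module structure
    can be found from the type alone. *)
Definition subspace_pred & is_subspace S : {pred V} := fun v => `[< S v >].

Let subspace_pred_closed : submod_closed (subspace_pred hS).
Proof.
case: hS => S0 SP; split=> [|k a b /asboolP ha /asboolP hb]; apply/asboolP => //.
exact: SP.
Qed.

HB.instance Definition _ :=
  GRing.isSubmodClosed.Build K V (subspace_pred hS) subspace_pred_closed.

Record subspace : Type :=
  Subspace { subspace_val : V; subspace_valP : subspace_val \in subspace_pred hS }.

HB.instance Definition _ := [isSub for subspace_val].
HB.instance Definition _ := [Choice of subspace by <:].
HB.instance Definition _ := [SubChoice_isSubLmodule of subspace by <:].

Definition to_subspace v (hv : S v) : subspace := Subspace (introT (asboolP _) hv).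

Lemma subspaceP (u : subspace) : S (subspace_val u).
Proof. exact/asboolP/subspace_valP. Qed.

Lemma subspace_val_linear : linear subspace_val.
Proof. exact: (linearP (val : subspace -> V)). Qed.

Lemma subspace_val_inj : injective subspace_val.
Proof. exact: val_inj. Qed.

End Subspace.

(** * The perm algebra of a bicommutant and a module over it *)

Section BicommutantAlgebra.
Variables (K : fieldType) (W : lmodType K) (D : W -> W) (S : set (W -> W)).
Hypotheses (D_linear : linear D) (S_linear : forall s, S s -> linear s).
Hypothesis S_comm : forall s t, S s -> S t -> s \o t = t \o s.
Hypothesis S_ad : forall s, S s -> S (fun w => D (s w) - s (D w)).

Let linB (f : W -> W) : linear f -> forall u v, f (u - v) = f u - f v.
Proof. by move=> hf u v; rewrite addrC -scaleN1r hf scaleN1r addrC. Qed.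

Definition commutant : set (W -> W) := [set f |
  linear f /\ forall s, S s -> forall w, f (s w) = s (f w)].

Definition bicommutant : set (W -> W) := [set f |
  linear f /\ forall g, commutant g -> forall w, f (g w) = g (f w)].

Lemma bicommutant_gen s : S s -> bicommutant s.
Proof. by move=> hs; split=> [|g [_ hg] w]; [exact: S_linear|rewrite hg]. Qed.

(** As S is commutative it lies in its commutant; so the elements of the
    bicommutant commute with S, hence lie in the commutant too. *)
Lemma bicommutant_comm f g :
  bicommutant f -> bicommutant g -> forall w, f (g w) = g (f w).
Proof.
move=> [_ hf] [lg hg]; apply: hf; split=> // s hs w; apply: hg.
by split=> [|t ht v]; [exact: S_linear|exact: (congr1 (@^~ v) (S_comm hs ht))].
Qed.

Let ad (f : W -> W) : W -> W := fun w => D (f w) - f (D w).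

Let ad_linear f : linear f -> linear (ad f).
Proof.
move=> hf k u v; rewrite /ad !(hf, D_linear) scalerBr opprD !addrA.
by congr (_ - _); rewrite addrAC.
Qed.

Let sub_swap (a b c e : W) : b - e = a - c -> a - b = c - e.
Proof.
move=> E; apply: (addIr (b - c)).
by rewrite addrA subrK -E [c - e]addrC [in RHS](addrC b) [RHS]addrA addrK addrC.
Qed.

(* By the Jacobi identity: [[D, g], s] = [D, [g, s]] - [g, [D, s]], and both
   terms vanish, the second because [D, s] is in S. *)
Let commutant_ad g : commutant g -> commutant (ad g).
Proof.
move=> [lg hg]; split=> [|s hs w]; first exact: ad_linear.
have ls := S_linear hs; have := hg _ (S_ad hs) w.
by rewrite /ad (linB lg) (linB ls) (hg s hs w) (hg s hs (D w)) => /sub_swap.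
Qed.

Let ad_comp f g w : linear f ->
  ad (fun v => f (g v)) w = ad f (g w) + f (ad g w).
Proof. by move=> lf; rewrite /ad (linB lf) addrA subrK. Qed.

Let bicommutant_ad f : bicommutant f -> bicommutant (ad f).
Proof.
move=> [lf hf]; split=> [|g hg w]; first exact: ad_linear.
have [lg _] := hg; have := hf _ (commutant_ad hg) w.
by rewrite /ad (linB lf) (linB lg) (hf g hg w) (hf g hg (D w)) => /sub_swap.
Qed.

Let bicommutant_comp f g :
  bicommutant f -> bicommutant g -> bicommutant (fun w => f (g w)).
Proof.
move=> [lf hf] [lg hg]; split=> [k u v|h hh w]; first by rewrite lg lf.
by rewrite hg // hf.
Qed.

Lemma bicommutant_subspace : is_subspace bicommutant.
Proof.
split; first by split=> [k u v|g [lg _] w];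
  rewrite /= ?scaler0 ?addr0 // -[0 in RHS](subrr 0) linB // subrr.
move=> k f g [lf hf] [lg hg]; split=> [c u v|h hh w].
  rewrite !fctE lf lg !scalerDr !scalerA mulrC -!addrA; congr (_ + _).
  by rewrite addrCA.
by rewrite !fctE hf // hg //; have [lh _] := hh; rewrite lh.
Qed.

Definition biop := subspace bicommutant_subspace.

(** The hypotheses on D and S are arguments so that the type determines its
    product and derivation. *)
Definition bicommutant_alg & linear D & (forall s, S s -> linear s)
    & (forall s t, S s -> S t -> s \o t = t \o s)
    & (forall s, S s -> S (fun w => D (s w) - s (D w))) : Type :=
  (biop * W)%type.

Local Notation bicomm_alg := (bicommutant_alg D_linear S_linear S_comm S_ad).

HB.instance Definition _ := GRing.Lmodule.on bicomm_alg.

Let bval (f : biop) : W -> W := subspace_val f.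
Let bvalP (f : biop) : bicommutant (bval f) := subspaceP f.

Let bmul (a b : bicomm_alg) : bicomm_alg :=
  (to_subspace bicommutant_subspace (bicommutant_comp (bvalP a.1) (bvalP b.1)),
   bval a.1 b.2).

Let bder (a : bicomm_alg) : bicomm_alg :=
  (to_subspace bicommutant_subspace (bicommutant_ad (bvalP a.1)), D a.2).

Let bval_lin k f g w : bval (k *: f + g) w = k *: bval f w + bval g w.
Proof. by rewrite /bval subspace_val_linear. Qed.

Let bext (a b : bicomm_alg) :
  (forall w, bval a.1 w = bval b.1 w) -> a.2 = b.2 -> a = b.
Proof.
case: a b => [f u] [g v] /= h ->; congr (_, _).
by apply: subspace_val_inj; apply: funext.
Qed.

Let bmul_linearl b : linear (bmul^~ b).
Proof. by move=> k x y; apply: bext => [w|]; rewrite /= ?bval_lin. Qed.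

Let bmul_linearr a : linear (bmul a).
Proof.
have [la _] := bvalP a.1.
by move=> k x y; apply: bext => [w|]; rewrite /= ?bval_lin la.
Qed.

HB.instance Definition _ :=
  hasBilinearProduct.Build K bicomm_alg bmul_linearl bmul_linearr.

Let bmulA : associative bmul.
Proof. by move=> a b c; apply: bext. Qed.

Let bmul_perm a b c : bmul (bmul a b) c = bmul (bmul b a) c.
Proof.
by apply: bext => [w|] /=; exact: (bicommutant_comm (bvalP a.1) (bvalP b.1)).
Qed.

HB.instance Definition _ := isPerm.Build K bicomm_alg bmulA bmul_perm.

Let bder_linear : linear bder.
Proof.
move=> k x y; apply: bext => [w|] /=; last by rewrite D_linear.
rewrite /ad !fctE D_linear scalerBr opprD !addrA.
by congr (_ - _); rewrite addrAC.
Qed.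

Let bderM a b : bder (bmul a b) = bmul (bder a) b + bmul a (bder b).
Proof.
have [la _] := bvalP a.1.
apply: bext => [w|] /=; last by rewrite /ad subrK.
by rewrite !fctE ad_comp.
Qed.

HB.instance Definition _ := hasDerivation.Build K bicomm_alg bder_linear bderM.

End BicommutantAlgebra.

(** * Operators on a perm algebra and their commutator with the derivation *)

Section Commutator.
Variables (K : fieldType) (F : derPermAlgType K).

(** For such p one has p \o bop a = bop (p a), so that composing with a left
    multiplication and evaluating at an element are the same operation. *)
Definition module_endo (p : F -> F) : Prop :=
  linear p /\ forall a c, p (bop a c) = bop (p a) c.

Definition ad_der (p : F -> F) : F -> F := fun c => der (p c) - p (der c).

Lemma linear_sub (U W : lmodType K) (p : U -> W) :
  linear p -> forall a c, p (a - c) = p a - p c.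
Proof. by move=> hp a c; rewrite addrC -scaleN1r hp scaleN1r addrC. Qed.

Lemma linear_zero (U W : lmodType K) (p : U -> W) : linear p -> p 0 = 0.
Proof. by move=> hp; rewrite -[0 in LHS](subrr 0) linear_sub // subrr. Qed.

Lemma linear_add (U W : lmodType K) (p : U -> W) :
  linear p -> forall a c, p (a + c) = p a + p c.
Proof. by move=> hp a c; rewrite -{1}(scale1r a) hp scale1r. Qed.

Lemma ad_der_comp p q c : linear p ->
  ad_der (p \o q) c = ad_der p (q c) + p (ad_der q c).
Proof. by move=> lp; rewrite /ad_der (linear_sub lp) addrA subrK. Qed.

Lemma ad_der_bop a : ad_der (bop a) = bop (der a).
Proof. by apply: funext => c; rewrite /ad_der derM addrK. Qed.

Lemma bopCA (a b c : F) : bop a (bop b c) = bop b (bop a c).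
Proof. by rewrite !bopA bop_perm. Qed.

Lemma module_endo_lin k p q :
  module_endo p -> module_endo q -> module_endo (k *: p + q).
Proof.
move=> [lp hp] [lq hq]; split=> [c u v|a c]; rewrite !fctE.
  rewrite lp lq !scalerDr !scalerA mulrC -!addrA; congr (_ + _).
  by rewrite addrCA.
by rewrite hp hq bop_linearl.
Qed.

Lemma module_endo_bop a : module_endo (bop a).
Proof. by split=> [|b c]; [exact: bop_linearr|rewrite bopA]. Qed.

Lemma module_endo_comp p q :
  module_endo p -> module_endo q -> module_endo (p \o q).
Proof.
move=> [lp hp] [lq hq]; split=> [c u v|a c] /=; first by rewrite lq lp.
by rewrite hq hp.
Qed.

Lemma ad_der_lin k p q : ad_der (k *: p + q) = k *: ad_der p + ad_der q.
Proof.
apply: funext => c; rewrite /ad_der !fctE der_linear scalerBr opprD !addrA.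
by congr (_ - _); rewrite addrAC.
Qed.

Lemma ad_der_endo p : module_endo p -> module_endo (ad_der p).
Proof.
move=> [lp hp]; split=> [k u v|a c]; rewrite /ad_der.
  rewrite lp !der_linear lp scalerBr opprD !addrA.
  by congr (_ - _); rewrite addrAC.
rewrite hp !derM (linear_add lp) !hp opprD addrACA subrr addr0.
by rewrite (linear_sub (bop_linearl c)).
Qed.

End Commutator.

(** * Homogeneous operators *)

Section SpecialImage.
Variables (K : fieldType) (F : derPermAlgType K) (B V : bilinAlgType K).
Variables (iota : B -> succ_alg F) (pi : B -> V).
Hypotheses (iota_hom : is_alg_hom iota) (iota_inj : injective iota).
Hypothesis pi_hom : is_alg_hom pi.

(** The flag records whether a factor from the kernel of pi is required: the
    letters form A for false and alpha for true.  Flags of products combine by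
    disjunction because alpha is an ideal. *)
Definition letter (e : bool) : set F :=
  [set a | exists2 b : B, a = iota b & e -> pi b = 0].

Let iotaM b c : iota (bop b c) = bop (der (iota b)) (iota c) :> F.
Proof. by have [_ ->] := iota_hom. Qed.

Lemma letter_lin e k a b : letter e a -> letter e b -> letter e (k *: a + b).
Proof.
have [li _] := iota_hom; have [lp _] := pi_hom.
move=> [a' -> ha] [b' -> hb]; exists (k *: a' + b'); first by rewrite li.
by move=> he; rewrite lp ha // hb // scaler0 addr0.
Qed.

Lemma letterM e1 e2 a b :
  letter e1 a -> letter e2 b -> letter (e1 || e2) (bop (der a) b).
Proof.
have [_ mp] := pi_hom.
move=> [a' -> ha] [b' -> hb]; exists (bop a' b'); first by rewrite iotaM.
rewrite mp => /orP[/ha|/hb] ->.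
  exact: (linear_zero (bop_linearl (pi b'))).
exact: (linear_zero (bop_linearr (pi a'))).
Qed.

(** The index n stands for the weight - n.+1, as in [Negz n]. *)
Inductive neg_op : bool -> nat -> (F -> F) -> Prop :=
| neg_letter e a : letter e a -> neg_op e 0 (bop a)
| neg_comp e1 e2 n p a : neg_op e1 n p -> letter e2 a ->
    neg_op (e1 || e2) n.+1 (p \o bop a)
| neg_lin e n k p q : neg_op e n p -> neg_op e n q -> neg_op e n (k *: p + q).

Fixpoint pos_op (e : bool) (n : nat) (p : F -> F) : Prop :=
  module_endo p /\ forall e' a, letter e' a ->
    if n is n'.+1 then pos_op (e || e') n' (p \o bop a)
    else letter (e || e') (p a).

Definition hom_op (e : bool) (w : int) : (F -> F) -> Prop :=
  match w with Posz n => pos_op e n | Negz n => neg_op e n end.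

Lemma hom_op_endo e w p : hom_op e w p -> module_endo p.
Proof.
case: w => n /=; first by case: n => [|n] [].
elim=> {e n p} [e a _|e1 e2 n p a _ IH _|e n k p q _ IHp _ IHq].
- exact: module_endo_bop.
- exact: module_endo_comp IH (module_endo_bop a).
- exact: module_endo_lin.
Qed.

Lemma hom_op_lin e w k p q :
  hom_op e w p -> hom_op e w q -> hom_op e w (k *: p + q).
Proof.
case: w => n /=; last exact: neg_lin.
elim: n e p q => [|n IH] e p q [mp hp] [mq hq]; split.
- exact: module_endo_lin.
- by move=> e' a ha; exact: letter_lin (hp _ _ ha) (hq _ _ ha).
- exact: module_endo_lin.
- by move=> e' a ha; exact: IH (hp _ _ ha) (hq _ _ ha).
Qed.

Lemma hom_op_letter e e' w p a : hom_op e w p -> letter e' a ->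
  hom_op (e || e') (w - 1) (p \o bop a).
Proof.
case: w => [[|n]|n] hp ha.
- case: hp => -[_ mp] hp.
  have -> : p \o bop a = bop (p a) by apply: funext => c /=; rewrite mp.
  exact/neg_letter/hp.
- by rewrite (_ : Posz n.+1 - 1 = n); [case: hp => _; exact|lia].
- by rewrite (_ : Negz n - 1 = Negz n.+1); [exact: neg_comp|lia].
Qed.

(** In negative weight the new factor d(a) is absorbed by the last letter b,
    since bop b and bop (der a) commute and d(a)b is again a letter. *)
Lemma hom_op_der_letter e e' w p a : hom_op e w p -> letter e' a ->
  hom_op (e || e') w (p \o bop (der a)).
Proof.
case: w => n hp ha.
  have mp : module_endo (p \o bop (der a)).
    exact: module_endo_comp (hom_op_endo hp) (module_endo_bop _).
  case: n hp => [|n] [_ hp]; split=> // e'' b hb.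
    by rewrite -orbA; apply: hp; exact: letterM.
  rewrite -orbA; have := hp _ _ (letterM ha hb).
  by congr pos_op; apply: funext => c /=; rewrite bopA.
elim: hp => {e n p} [e b hb|e1 e2 n p b hp _ hb|e n k p q _ IHp _ IHq].
- rewrite orbC (_ : _ \o _ = bop (bop (der a) b)).
    exact/neg_letter/letterM.
  by apply: funext => c /=; rewrite bopCA bopA.
- rewrite -orbA [e2 || _]orbC (_ : _ \o _ = p \o bop (bop (der a) b)).
    exact/neg_comp/letterM.
  by apply: funext => c /=; rewrite bopCA bopA.
- exact: neg_lin.
Qed.

Lemma der_letter e a : letter e a -> hom_op e 0 (bop (der a)).
Proof.
by move=> ha; split=> [|e' b hb]; [exact: module_endo_bop|exact: letterM].
Qed.

Lemma hom_op_add e w p q : hom_op e w p -> hom_op e w q -> hom_op e w (p + q).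
Proof. by rewrite -{2}(scale1r p); exact: hom_op_lin. Qed.

Lemma hom_op_sub e w p q : hom_op e w p -> hom_op e w q -> hom_op e w (p - q).
Proof. by rewrite addrC -scaleN1r => hp hq; exact: hom_op_lin. Qed.

Lemma ad_der_comp_bop p (a : F) : module_endo p ->
  ad_der (p \o bop a) = (ad_der p \o bop a) + (p \o bop (der a)).
Proof.
by move=> [lp _]; apply: funext => c; rewrite ad_der_comp // ad_der_bop.
Qed.

(** By the Leibniz rule [d, p] L_a = [d, p L_a] - p L_{da}.  The operator p L_a
    has smaller weight and p L_{da} is controlled by [hom_op_der_letter]; in
    nonnegative weight this is an induction on the weight, starting from
    [d, L_a] = L_{da}. *)
Lemma hom_op_der e w p : hom_op e w p -> hom_op e (w + 1) (ad_der p).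
Proof.
have key p' (a : F) : module_endo p' ->
    ad_der p' \o bop a = ad_der (p' \o bop a) - (p' \o bop (der a)).
  by move=> hp'; rewrite ad_der_comp_bop // addrK.
case: w => n.
  rewrite (_ : Posz n + 1 = n.+1); last by lia.
  elim: n e p => [|n IH] e p hp; have mp := hom_op_endo hp;
    split=> [|e' a ha]; try exact: ad_der_endo; rewrite key //.
    apply: (@hom_op_sub _ 0); last exact: hom_op_der_letter.
    case: hp => -[_ hpM] hp.
    rewrite (_ : p \o bop a = bop (p a)); last first.
      by apply: funext => c /=; rewrite hpM.
    by rewrite ad_der_bop; apply: der_letter; apply: hp.
  apply: (@hom_op_sub _ n.+1); last exact: hom_op_der_letter.
  by apply: IH; case: hp => _; apply.
elim=> {e n p} [e a ha|e1 e2 n p a hp IH ha|e n k p q _ IHp _ IHq].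
- by rewrite ad_der_bop; exact: der_letter.
- rewrite ad_der_comp_bop; last exact: (@hom_op_endo e1 (Negz n)).
  rewrite (_ : Negz n.+1 + 1 = Negz n); last by lia.
  apply: hom_op_add; last exact: (@hom_op_der_letter _ _ (Negz n)).
  have := hom_op_letter IH ha.
  by rewrite addrK.
- by rewrite ad_der_lin; exact: hom_op_lin.
Qed.

(** The same identity, solved for p L_{da}, reduces the letter d^(k+1) a to
    d^k a. *)
Lemma hom_op_iter_der e e' w p a k : hom_op e w p -> letter e' a ->
  hom_op (e || e') (w + k%:Z - 1) (p \o bop (iter k der a)).
Proof.
elim: k w p => [|k IH] w p hp ha; first by rewrite addr0; exact: hom_op_letter.
have mp := hom_op_endo hp.
rewrite (_ : p \o _ = ad_der (p \o bop (iter k der a))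
                      - (ad_der p \o bop (iter k der a))).
  apply: hom_op_sub.
    rewrite (_ : w + k.+1%:Z - 1 = w + k%:Z - 1 + 1); last by lia.
    exact/hom_op_der/IH.
  rewrite (_ : w + k.+1%:Z - 1 = w + 1 + k%:Z - 1); last by lia.
  exact/IH/ha/hom_op_der.
by rewrite ad_der_comp_bop // addrAC subrr add0r.
Qed.

(** * Functionals on homogeneous operators *)

(** An operator may have several weights; keeping the weight as data makes the
    grading an external one, with no question of directness. *)
Record homog : Type := Homog
  { weight : int; op : F -> F; op_homog : hom_op false weight op }.

Lemma homog_eq x y : weight x = weight y -> op x = op y -> x = y.
Proof.
case: x y => [w p hp] [w' p' hp'] /= Ew Ep.
by case: _ / Ew hp' => hp'; case: _ / Ep hp' => hp'; congr Homog.
Qed.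

Lemma letter_iota b : letter false (iota b).
Proof. by exists b. Qed.

Lemma letter_ker b : pi b = 0 -> letter true (iota b).
Proof. by exists b. Qed.

Definition homog_mul (k : nat) (b : B) (x : homog) : homog :=
  Homog (hom_op_iter_der k (op_homog x) (letter_iota b)).

Definition homog_der (x : homog) : homog := Homog (hom_op_der (op_homog x)).

Definition functional : set (homog -> V) := [set T |
  (forall k x y z, weight z = weight x -> weight z = weight y ->
     op z = k *: op x + op y -> T z = k *: T x + T y) /\
  (forall x, hom_op true (weight x) (op x) -> T x = 0)].

Lemma functional_subspace : is_subspace functional.
Proof.
split; first by split=> // *; rewrite /= scaler0 addr0.
move=> c T U [lT kT] [lU kU]; split=> [k x y z hx hy hz|x hx].
  rewrite !fctE (lT k x y z) // (lU k x y z) // !scalerDr !scalerA mulrC -!addrA.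
  by congr (_ + _); rewrite addrCA.
by rewrite !fctE kT // kU // scaler0 addr0.
Qed.

Definition dual := subspace functional_subspace.

Definition dual_fun (T : dual) : homog -> V := subspace_val T.

Lemma dual_fun_lin (T : dual) k x y z :
  weight z = weight x -> weight z = weight y ->
  op z = k *: op x + op y -> dual_fun T z = k *: dual_fun T x + dual_fun T y.
Proof. by have [h _] := subspaceP T; exact: h. Qed.

Lemma dual_fun_kill (T : dual) x :
  hom_op true (weight x) (op x) -> dual_fun T x = 0.
Proof. by have [_ h] := subspaceP T; exact: h. Qed.

Lemma dual_ext (T U : dual) : (forall x, dual_fun T x = dual_fun U x) -> T = U.
Proof. by move=> h; apply: subspace_val_inj; apply: funext. Qed.

Lemma dual_fun_linear k T U x :
  dual_fun (k *: T + U) x = k *: dual_fun T x + dual_fun U x.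
Proof. by rewrite /dual_fun subspace_val_linear. Qed.

Lemma shift_functional k b T :
  functional (fun x => dual_fun T (homog_mul k b x)).
Proof.
split=> [c x y z hx hy hz|x hx].
  apply: dual_fun_lin; rewrite /= ?hx ?hy //.
    by rewrite -hx hy.
  by rewrite hz; apply: funext.
by apply: dual_fun_kill; exact: hom_op_iter_der hx (letter_iota b).
Qed.

Definition shift k b (T : dual) : dual :=
  to_subspace functional_subspace (shift_functional k b T).

Lemma coder_functional T : functional (fun x => - dual_fun T (homog_der x)).
Proof.
split=> [c x y z hx hy hz|x hx].
  rewrite scalerN -opprD; congr (- _); apply: dual_fun_lin.
  - by rewrite /= hx.
  - by rewrite /= hy.
  - by rewrite /= hz ad_der_lin.
by rewrite dual_fun_kill ?oppr0 //; exact: hom_op_der hx.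
Qed.

(** The sign is that of integration by parts: with it, the commutator of
    [coder] with multiplication by a letter is multiplication by its
    derivative ([shift_coder]). *)
Definition coder (T : dual) : dual :=
  to_subspace functional_subspace (coder_functional T).

Lemma coder_linear : linear coder.
Proof.
move=> k T U; apply: dual_ext => x; rewrite dual_fun_linear /dual_fun /=.
by rewrite scalerN -opprD.
Qed.

Lemma shift_linear k b : linear (shift k b).
Proof.
by move=> c T U; apply: dual_ext => x; rewrite !dual_fun_linear.
Qed.

Lemma shift_comm j k a b T : shift j a (shift k b T) = shift k b (shift j a T).
Proof.
apply: dual_ext => x; congr (dual_fun T _); apply: homog_eq => /=; first by lia.
by apply: funext => c /=; rewrite bopCA.
Qed.

Lemma shift_coder k b T :
  coder (shift k b T) - shift k b (coder T) = shift k.+1 b T.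
Proof.
apply: dual_ext => x.
have -> : dual_fun (coder (shift k b T) - shift k b (coder T)) x =
    - dual_fun T (homog_mul k b (homog_der x))
    + dual_fun T (homog_der (homog_mul k b x)).
  by rewrite addrC -scaleN1r dual_fun_linear addrC scaleN1r opprK.
rewrite addrC; apply/eqP; rewrite subr_eq addrC; apply/eqP.
rewrite -[dual_fun T (homog_mul _ _ _)]scale1r.
apply: dual_fun_lin => /=; [lia|lia|].
by rewrite scale1r ad_der_comp_bop //; exact: hom_op_endo (op_homog x).
Qed.

Lemma shift0_linear T k a b :
  shift 0 (k *: a + b) T = k *: shift 0 a T + shift 0 b T.
Proof.
have [li _] := iota_hom.
apply: dual_ext => x; rewrite dual_fun_linear.
apply: (@dual_fun_lin T k (homog_mul 0 a x) (homog_mul 0 b x)) => //=.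
apply: funext => c; have [lx _] := hom_op_endo (op_homog x).
by rewrite !fctE li bop_linearl lx.
Qed.

Lemma shift0_ker b T : pi b = 0 -> shift 0 b T = 0.
Proof.
move=> hb; apply: dual_ext => x; rewrite /dual_fun /=; apply: dual_fun_kill.
exact: (hom_op_iter_der 0 (op_homog x) (letter_ker hb)).
Qed.

Definition shifts : set (dual -> dual) := [set s | exists k b, s = shift k b].

Lemma shifts_linear s : shifts s -> linear s.
Proof. by move=> [k [b ->]]; exact: shift_linear. Qed.

Lemma shifts_comm s t : shifts s -> shifts t -> s \o t = t \o s.
Proof.
by move=> [j [a ->]] [k [b ->]]; apply: funext => T; exact: shift_comm.
Qed.

Lemma shifts_ad s : shifts s -> shifts (fun T => coder (s T) - s (coder T)).
Proof.
by move=> [k [b ->]]; exists k.+1, b; apply: funext => T; exact: shift_coder.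
Qed.

(** * The embedding *)

Definition target : derPermAlgType K :=
  bicommutant_alg coder_linear shifts_linear shifts_comm shifts_ad.

(** The partial map A -> V induced by pi, extended by zero. *)
Definition value (f : F) : V :=
  if pselect (exists b, f = iota b) is left h then pi (projT1 (cid h)) else 0.

Lemma value_iota b : value (iota b) = pi b.
Proof.
rewrite /value; case: pselect => [h|[]]; last by exists b.
by case: cid => c /= /iota_inj ->.
Qed.

Lemma value_lin k f g : letter false f -> letter false g ->
  value (k *: f + g) = k *: value f + value g.
Proof.
have [li _] := iota_hom; have [lp _] := pi_hom.
by move=> [a -> _] [b -> _]; rewrite -[_ + _]li !value_iota lp.
Qed.

Lemma hom_op0_letter e p b : hom_op e 0 p -> letter e (p (iota b)).
Proof. by case=> _ /(_ _ _ (letter_iota b)); rewrite orbF. Qed.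

Lemma eval_functional b :
  functional (fun x => if weight x == 0 then value (op x (iota b)) else 0).
Proof.
split=> [k x y z hx hy hz|x hx].
  rewrite -hx -hy; case: eqP => [z0|_]; last by rewrite scaler0 addr0.
  rewrite hz !fctE; apply: value_lin; apply: hom_op0_letter; rewrite -z0.
    by rewrite hx; exact: op_homog.
  by rewrite hy; exact: op_homog.
case: eqP => // x0; rewrite x0 in hx.
have [c -> hc] := hom_op0_letter b hx.
by rewrite value_iota hc.
Qed.

Definition eval_at (b : B) : dual :=
  to_subspace functional_subspace (eval_functional b).

Lemma eval_at_linear : linear eval_at.
Proof.
have [li _] := iota_hom.
move=> k a b; apply: dual_ext => x; rewrite dual_fun_linear /dual_fun /=.
case: eqP => [x0|_]; last by rewrite scaler0 addr0.
have hx := op_homog x; have [lx _] := hom_op_endo hx; rewrite x0 in hx.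
by rewrite li [op x _]lx value_lin //; exact: hom_op0_letter.
Qed.

Lemma eval_at_ker b : pi b = 0 -> eval_at b = 0.
Proof.
move=> hb; apply: dual_ext => x; rewrite /dual_fun /=; case: eqP => // x0.
have := op_homog x; rewrite x0 => -[_ /(_ _ _ (letter_ker hb)) /=].
by case=> c -> hc; rewrite value_iota hc.
Qed.

Lemma shift1_eval_at a b : shift 1 a (eval_at b) = eval_at (bop a b).
Proof.
apply: dual_ext => x; rewrite /dual_fun /= addrK iotaM.
by [].
Qed.

Lemma shift1_shift0 a b T : shift 1 a (shift 0 b T) = shift 0 (bop a b) T.
Proof.
apply: dual_ext => x; congr (dual_fun T _); apply: homog_eq => /=; first by lia.
by apply: funext => c /=; rewrite iotaM bopA.
Qed.

Lemma id_hom_op : hom_op false 0 id.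
Proof. by split=> // -[|] a. Qed.

Lemma eval_at_id b : dual_fun (eval_at b) (Homog id_hom_op) = pi b.
Proof. by rewrite /dual_fun /= value_iota. Qed.

Lemma shift0_bicommutant b : bicommutant shifts (shift 0 b).
Proof. by apply: bicommutant_gen; [exact: shifts_linear|exists 0%N, b]. Qed.

Definition embed (b : B) : succ_alg target :=
  (to_subspace (bicommutant_subspace shifts) (shift0_bicommutant b), eval_at b).

Lemma target_ext (S T : target) :
  (forall w, subspace_val S.1 w = subspace_val T.1 w) -> S.2 = T.2 -> S = T.
Proof.
case: S T => [f u] [g v] /= h ->; congr (_, _).
by apply: subspace_val_inj; apply: funext.
Qed.

Lemma embed_hom : is_alg_hom embed.
Proof.
split=> [k a b|a b]; apply: target_ext => //=.
- by move=> T; rewrite shift0_linear.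
- exact: eval_at_linear.
- by move=> T; rewrite shift_coder shift1_shift0.
- by rewrite shift_coder shift1_eval_at.
Qed.

Lemma embed_ker b : pi b = 0 -> embed b = 0.
Proof.
move=> hb; apply: target_ext => /= [T|]; first exact: shift0_ker.
exact: eval_at_ker.
Qed.

Lemma embed_inj b : embed b = 0 -> pi b = 0.
Proof. by rewrite -eval_at_id => E; rewrite (congr1 snd E : eval_at b = 0). Qed.

Lemma special_surjective_image : (forall v, exists b, pi b = v) -> is_special V.
Proof.
(* A set-theoretic section of pi is enough: embed factors through pi. *)
move=> /choice [s sK]; have [le me] := embed_hom; have [lp mp] := pi_hom.
have embed_eq a b : pi a = pi b -> embed a = embed b.
  move=> E; apply/eqP; rewrite -subr_eq0 -linear_sub //; apply/eqP/embed_ker.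
  by rewrite linear_sub // E subrr.
exists target, (embed \o s); split; first split=> [k u v|u v] /=.
- by rewrite -le; apply: embed_eq; rewrite lp !sK.
- by rewrite -me; apply: embed_eq; rewrite mp !sK.
move=> u v /= E; rewrite -[u]sK -[v]sK; apply/eqP; rewrite -subr_eq0.
by rewrite -linear_sub //; apply/eqP/embed_inj; rewrite linear_sub // E subrr.
Qed.

End SpecialImage.

(** * Homomorphic images of special algebras *)

Theorem special_image (K : fieldType) (B V : bilinAlgType K) (pi : B -> V) :
  is_special B -> is_alg_hom pi -> (forall v, exists b, pi b = v) ->
  is_special V.
Proof.
move=> [F [iota [iota_hom iota_inj]]].
exact: special_surjective_image iota_hom iota_inj.
Qed.

Theorem theorem3 (K : fieldType) (X : Type) (F : derPermAlgType K) (i : X -> F)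
    (hF : is_free_der_perm i) (alpha : set (DerPerm_succ i))
    (halpha : is_ideal alpha) :
  is_special (quot_alg halpha).
Proof.
apply: (@special_image _ (DerPerm_succ i) _ _ _ (quot_pi_hom halpha)) => [|v].
  exists F, (@gen_val K (succ_alg F) (range i)); split; last exact: gen_val_inj.
  by split; [exact: gen_val_linear|exact: gen_valM].
by exists (repr v); rewrite reprK.
Qed.
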